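(* Let $(A,\cdot,\Phi=\{\partial_k\}_{k=1}^m)$ be a $\Psi=\{\eth_k\}_{k=1}^m$-admissible differential algebra and let $r\in A\otimes A$. If $r$ is an antisymmetric solution of the $\Psi$-admissible associative Yang--Baxter equation in $(A,\cdot,\Phi)$, then $(A,\cdot,\Delta,\Phi,\Psi)$ is a differential ASI bialgebra, where the linear map $\Delta\colon A\to A\otimes A$ is defined by $$\Delta(a)=(\mathrm{id}\otimes L_A(a)-R_A(a)\otimes\mathrm{id})(r),\qquad a\in A.$$
   Context: All vector spaces and algebras are finite-dimensional over a field $\mathbb F$ of characteristic $0$; ''algebra'' means associative algebra, not necessarily unital. $\sigma(a\otimes b)=b\otimes a$; $r$ is antisymmetric if $r=-\sigma(r)$. $L_A(a)b=a\cdot b=R_A(b)a$. Differential algebra $(A,\cdot,\Phi=\{\partial_k\}_{k=1}^m)$: $(A,\cdot)$ is an algebra and the $\partial_k$ are pairwise commuting derivations. For a set $\Psi=\{\eth_k\colon A\to A\}_{k=1}^m$ of pairwise commuting linear maps, $(A,\cdot,\Phi)$ is $\Psi$-admissible if for all $k$ and $a,b\in A$: $\eth_k(a)\cdot b=a\cdot\partial_k(b)+\eth_k(a\cdot b)$ and $a\cdot\eth_k(b)=\partial_k(a)\cdot b+\eth_k(a\cdot b)$. $r=\sum_ia_i\otimes b_i$ is a solution of the $\Psi$-admissible associative Yang--Baxter equation (AYBE) in $(A,\cdot,\Phi)$ if $r_{12}r_{13}+r_{13}r_{23}-r_{23}r_{12}=0$, where $r_{12}r_{13}=\sum_{i,j}a_i\cdot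 a_j\otimes b_i\otimes b_j$, $r_{13}r_{23}=\sum_{i,j}a_i\otimes a_j\otimes b_i\cdot b_j$, $r_{23}r_{12}=\sum_{i,j}a_j\otimes a_i\cdot b_j\otimes b_i$, and for all $k$: $(\partial_k\otimes\mathrm{id}-\mathrm{id}\otimes\eth_k)(r)=0$, $(\eth_k\otimes\mathrm{id}-\mathrm{id}\otimes\partial_k)(r)=0$. ASI bialgebra $(A,\cdot,\Delta)$: $(A,\cdot)$ is an algebra, $(A,\Delta)$ is a coassociative coalgebra (counit not required), and for all $a,b\in A$ $$\Delta(a\cdot b)=(R_A(b)\otimes\mathrm{id})\Delta(a)+(\mathrm{id}\otimes L_A(a))\Delta(b),$$ $$(L_A(a)\otimes\mathrm{id}-\mathrm{id}\otimes R_A(a))\Delta(b)=\sigma\big((\mathrm{id}\otimes R_A(b)-L_A(b)\otimes\mathrm{id})\Delta(a)\big).$$ Differential ASI bialgebra $(A,\cdot,\Delta,\Phi,\Psi)$: $(A,\cdot,\Delta)$ is an ASI bialgebra; $(A,\cdot,\Phi)$ is a $\Psi$-admissible differential algebra; the $\eth_k$ are pairwise commuting coderivations, i.e. $\Delta\eth_k=(\eth_k\otimes\mathrm{id}+\mathrm{id}\otimes\eth_k)\Delta$; and for all $k$: $(\partial_k\otimes\mathrm{id})\Delta=(\mathrm{id}\otimes\eth_k)\Delta+\Delta\partial_k$, $(\mathrm{id}\otimes\partial_k)\Delta=(\eth_k\otimes\mathrm{id})\Delta+\Delta\partial_k$. *)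

(* Defs.v *)
From HB Require Import structures.
From mathcomp Require Import all_boot all_order all_algebra.

Set Implicit Arguments.
Unset Strict Implicit.
Unset Printing Implicit Defensive.

Import GRing.Theory.
Local Open Scope ring_scope.

(* MathComp has no tensor product of vector spaces.  We use the coordinate
   model: an element of U ⊗ V is its matrix of coordinates in the family
   e_i ⊗ f_j, where e and f are the chosen bases (vbasis) of U and V.  All the
   operations below go through tlift, the linear map out of U ⊗ V induced by
   a bilinear map; the universal property (tlift_tpure, tlift_linear,
   tensor_ext) shows that nothing depends on the chosen bases. *)

Definition tensor (F : fieldType) (U V : vectType F) : Type :=
  'M[F]_(\dim {:U}, \dim {:V}).

HB.instance Definition _ (F : fieldType) (U V : vectType F) :=
  Vector.on (tensor U V).

Section TensorProduct.
Variable F : fieldType.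
Implicit Types U V W : vectType F.

Definition tpure U V (u : U) (v : V) : tensor U V :=
  \matrix_(i, j) (coord (vbasis {:U}) i u * coord (vbasis {:V}) j v).

(* Only meaningful when f is bilinear. *)
Definition tlift U V W (f : U -> V -> W) (t : tensor U V) : W :=
  \sum_(i < \dim {:U}) \sum_(j < \dim {:V})
     t i j *: f (vbasis {:U})`_i (vbasis {:V})`_j.

End TensorProduct.

Notation "u ⊗ v" := (tpure u v) (at level 40, left associativity) : ring_scope.

Section TensorMaps.
Variable F : fieldType.
Implicit Types U V W : vectType F.

Definition tmap U V U' V' (f : U -> U') (g : V -> V') :
    tensor U V -> tensor U' V' :=
  tlift (fun u v => f u ⊗ g v).

Definition tswap U V : tensor U V -> tensor V U := tlift (fun u v => v ⊗ u).

Definition tassoc U V W : tensor (tensor U V) W -> tensor U (tensor V W) :=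
  tlift (fun t w => tlift (fun u v => u ⊗ (v ⊗ w)) t).

End TensorMaps.

Section TensorTheory.
Variable F : fieldType.
Implicit Types U V W : vectType F.

Lemma tpure_linearl U V (v : V) : linear (fun u : U => u ⊗ v).
Proof.
by move=> c x y; apply/matrixP=> i j; rewrite !mxE linearP mulrDl mulrA.
Qed.

Lemma tpure_linearr U V (u : U) : linear (fun v : V => u ⊗ v).
Proof.
by move=> c x y; apply/matrixP=> i j; rewrite !mxE linearP mulrDr mulrCA.
Qed.

Lemma tlift_linear U V W (f : U -> V -> W) : linear (tlift f).
Proof.
move=> c x y; rewrite /tlift scaler_sumr -big_split; apply: eq_bigr => i _.
rewrite scaler_sumr -big_split; apply: eq_bigr => j _.
by rewrite /= !mxE scalerDl scalerA.
Qed.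

Lemma linear_sumZ U W (f : U -> W) (I : finType) (c : I -> F) (x : I -> U) :
  linear f -> f (\sum_i c i *: x i) = \sum_i c i *: f (x i).
Proof.
move=> lf.
pose g : {linear U -> W} := HB.pack f (GRing.isLinear.Build F U W _ f lf).
rewrite -[f]/(g : U -> W) linear_sum; apply: eq_bigr => i _.
by rewrite linearZ.
Qed.

Lemma tlift_tpure U V W (f : U -> V -> W) (u : U) (v : V) :
  (forall y, linear (f^~ y)) -> (forall x, linear (f x)) ->
  tlift f (u ⊗ v) = f u v.
Proof.
move=> fl fr.
rewrite {2}(coord_vbasis (memvf u)) (linear_sumZ _ _ (fl v)).
apply: eq_bigr => i _.
rewrite {2}(coord_vbasis (memvf v)) (linear_sumZ _ _ (fr _)) scaler_sumr.
by apply: eq_bigr => j _; rewrite mxE scalerA.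
Qed.

Lemma tensor_expand U V (t : tensor U V) :
  t = \sum_i \sum_j t i j *: ((vbasis {:U})`_i ⊗ (vbasis {:V})`_j).
Proof.
have fb (X : vectType F) : free (vbasis {:X}) by exact: basis_free (vbasisP _).
rewrite {1}[t]matrix_sum_delta; apply: eq_bigr => i _; apply: eq_bigr => j _.
congr (_ *: _); apply/matrixP=> i' j'; rewrite !mxE !coord_free //.
by rewrite (eq_sym i') (eq_sym j') -natrM mulnb.
Qed.

Lemma tensor_ext U V W (f g : tensor U V -> W) :
  linear f -> linear g -> (forall u v, f (u ⊗ v) = g (u ⊗ v)) -> f =1 g.
Proof.
move=> lf lg fg t; rewrite (tensor_expand t) !pair_big.
rewrite !(linear_sumZ (fun p => t p.1 p.2)
  (fun p => (vbasis {:U})`_p.1 ⊗ (vbasis {:V})`_p.2)) //.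
by apply: eq_bigr => p _; rewrite fg.
Qed.

Lemma tlift_sum U V W (f : U -> V -> W) n (a : 'I_n -> U) (b : 'I_n -> V) :
  (forall y, linear (f^~ y)) -> (forall x, linear (f x)) ->
  tlift f (\sum_i a i ⊗ b i) = \sum_i f (a i) (b i).
Proof.
move=> fl fr; under eq_bigr => i _ do rewrite -[_ ⊗ _]scale1r.
rewrite (linear_sumZ _ _ (tlift_linear f)); apply: eq_bigr => i _.
by rewrite scale1r tlift_tpure.
Qed.

End TensorTheory.

Section DifferentialASI.
Variables (F : fieldType) (A : vectType F).
Implicit Types (mul : A -> A -> A) (Delta : A -> tensor A A).
Implicit Types (r : tensor A A).

Definition Lmul mul (a : A) : A -> A := fun b => mul a b.
Definition Rmul mul (a : A) : A -> A := fun b => mul b a.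

Record is_algebra mul : Prop := {
  alg_linearl : forall b, linear (mul^~ b);
  alg_linearr : forall a, linear (mul a);
  alg_assoc : associative mul }.

Definition is_derivation mul (d : 'End(A)) : Prop :=
  forall a b, d (mul a b) = mul (d a) b + mul a (d b).

Definition pairwise_commuting m (D : 'I_m -> 'End(A)) : Prop :=
  forall k l a, D k (D l a) = D l (D k a).

Record is_diff_algebra m mul (Phi : 'I_m -> 'End(A)) : Prop := {
  diff_alg : is_algebra mul;
  diff_derivation : forall k, is_derivation mul (Phi k);
  diff_commuting : pairwise_commuting Phi }.

Record is_admissible m mul (Phi Psi : 'I_m -> 'End(A)) : Prop := {
  adm_commuting : pairwise_commuting Psi;
  adm_left : forall k a b,
    mul (Psi k a) b = mul a (Phi k b) + Psi k (mul a b);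
  adm_right : forall k a b,
    mul a (Psi k b) = mul (Phi k a) b + Psi k (mul a b) }.

Definition is_antisymmetric r : Prop := r = - tswap r.

(* A ⊗ A ⊗ A is read as A ⊗ (A ⊗ A).  The pairs (ai, bi) and (aj, bj) run over
   two copies of r = \sum_i ai ⊗ bi; see r12r13E, r13r23E and r23r12E. *)
Definition r12r13 mul r : tensor A (tensor A A) :=
  tlift (fun ai bi => tlift (fun aj bj => mul ai aj ⊗ (bi ⊗ bj)) r) r.
Definition r13r23 mul r : tensor A (tensor A A) :=
  tlift (fun ai bi => tlift (fun aj bj => ai ⊗ (aj ⊗ mul bi bj)) r) r.
Definition r23r12 mul r : tensor A (tensor A A) :=
  tlift (fun ai bi => tlift (fun aj bj => aj ⊗ (mul ai bj ⊗ bi)) r) r.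

Record is_admissible_AYBE_solution m mul (Phi Psi : 'I_m -> 'End(A)) r :
    Prop := {
  aybe_eq : r12r13 mul r + r13r23 mul r - r23r12 mul r = 0;
  aybe_PhiPsi : forall k, tmap (Phi k) id r - tmap id (Psi k) r = 0;
  aybe_PsiPhi : forall k, tmap (Psi k) id r - tmap id (Phi k) r = 0 }.

Record is_coalgebra Delta : Prop := {
  coalg_linear : linear Delta;
  coalg_coassoc : forall a,
    tassoc (tmap Delta id (Delta a)) = tmap id Delta (Delta a) }.

Record is_ASI_bialgebra mul Delta : Prop := {
  asi_alg : is_algebra mul;
  asi_coalg : is_coalgebra Delta;
  asi_mul : forall a b,
    Delta (mul a b) =
      tmap (Rmul mul b) id (Delta a) + tmap id (Lmul mul a) (Delta b);
  asi_swap : forall a b,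
    tmap (Lmul mul a) id (Delta b) - tmap id (Rmul mul a) (Delta b) =
      tswap (tmap id (Rmul mul b) (Delta a) - tmap (Lmul mul b) id (Delta a))
  }.

Definition is_coderivation Delta (d : 'End(A)) : Prop :=
  forall a, Delta (d a) = tmap d id (Delta a) + tmap id d (Delta a).

Record is_diff_ASI_bialgebra m mul Delta (Phi Psi : 'I_m -> 'End(A)) :
    Prop := {
  dasi_asi : is_ASI_bialgebra mul Delta;
  dasi_diff : is_diff_algebra mul Phi;
  dasi_adm : is_admissible mul Phi Psi;
  dasi_coder : forall k, is_coderivation Delta (Psi k);
  dasi_Phil : forall k a,
    tmap (Phi k) id (Delta a) = tmap id (Psi k) (Delta a) + Delta (Phi k a);
  dasi_Phir : forall k a,
    tmap id (Phi k) (Delta a) = tmap (Psi k) id (Delta a) + Delta (Phi k a) }.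

End DifferentialASI.

Section AYBETerms.
Variables (F : fieldType) (A : vectType F) (mul : A -> A -> A).
Hypothesis algA : is_algebra mul.
Variables (n : nat) (a b : 'I_n -> A).
Let r : tensor A A := \sum_i a i ⊗ b i.

Lemma tlift2_sum (W : vectType F) (f : A -> A -> A -> A -> W) :
    (forall y z t, linear (fun x => f x y z t)) ->
    (forall x z t, linear (fun y => f x y z t)) ->
    (forall x y t, linear (fun z => f x y z t)) ->
    (forall x y z, linear (fun t => f x y z t)) ->
  tlift (fun x y => tlift (fun z t => f x y z t) r) r =
    \sum_i \sum_j f (a i) (b i) (a j) (b j).
Proof.
move=> f1 f2 f3 f4.
have E x y : tlift (f x y) r = \sum_j f x y (a j) (b j).
  by apply: tlift_sum => [t|z]; [exact: f3 | exact: f4].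
rewrite [LHS]tlift_sum; first by apply: eq_bigr => i _; exact: E.
- move=> y c x x'; rewrite !E scaler_sumr -big_split; apply: eq_bigr => j _.
  exact: f1.
- move=> x c y y'; rewrite !E scaler_sumr -big_split; apply: eq_bigr => j _.
  exact: f2.
Qed.

Let mull := alg_linearl algA.
Let mulr := alg_linearr algA.

Lemma r12r13E :
  r12r13 mul r = \sum_i \sum_j mul (a i) (a j) ⊗ (b i ⊗ b j).
Proof.
apply: (tlift2_sum (f := fun x y z t => mul x z ⊗ (y ⊗ t))).
- by move=> y z t c x x'; rewrite mull tpure_linearl.
- by move=> x z t c y y'; rewrite tpure_linearl tpure_linearr.
- by move=> x y t c z z'; rewrite mulr tpure_linearl.
- by move=> x y z c t t'; rewrite !tpure_linearr.
Qed.

Lemma r13r23E :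
  r13r23 mul r = \sum_i \sum_j a i ⊗ (a j ⊗ mul (b i) (b j)).
Proof.
apply: (tlift2_sum (f := fun x y z t => x ⊗ (z ⊗ mul y t))).
- by move=> y z t c x x'; rewrite tpure_linearl.
- by move=> x z t c y y'; rewrite mull !tpure_linearr.
- by move=> x y t c z z'; rewrite tpure_linearl tpure_linearr.
- by move=> x y z c t t'; rewrite mulr !tpure_linearr.
Qed.

Lemma r23r12E :
  r23r12 mul r = \sum_i \sum_j a j ⊗ (mul (a i) (b j) ⊗ b i).
Proof.
apply: (tlift2_sum (f := fun x y z t => z ⊗ (mul x t ⊗ y))).
- by move=> y z t c x x'; rewrite mull tpure_linearl tpure_linearr.
- by move=> x z t c y y'; rewrite !tpure_linearr.
- by move=> x y t c z z'; rewrite tpure_linearl.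
- by move=> x y z c t t'; rewrite mulr tpure_linearl tpure_linearr.
Qed.

End AYBETerms.

(* Main.v *)
From HB Require Import structures.
Require Import Defs.
From mathcomp Require Import all_boot all_order all_algebra.

Set Implicit Arguments.
Unset Strict Implicit.
Unset Printing Implicit Defensive.

Import GRing.Theory.
Local Open Scope ring_scope.

(** Write [r = \sum_i a i ⊗ b i], so that
    [Delta x = \sum_i (a i ⊗ x * b i - a i * x ⊗ b i)].  The axioms fall into
    three groups, each with its own reason.

    - Compatibility of [Delta] with the product is formal.  In the first
      identity the mixed terms [a i * y ⊗ x * b i] cancel.  In the second the
      flip exchanges the two sides up to replacing [r] by [tswap r], and
      antisymmetry says exactly that this costs a sign.

    - Coassociativity is where the Yang-Baxter equation enters.  Expanding both
      iterated coproducts of [x], the two terms having [x] in the middle slot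
      agree, and the others regroup ([coboundary_coassocE]) as
      [(R_x ⊗ id ⊗ id) Y - (id ⊗ id ⊗ L_x) Y], where [Y] is the left-hand side
      of the Yang-Baxter equation.

    - The conditions on [Phi] and [Psi] come from the linear equations on [r],
      which move [Phi k] on one leg of [r] to [Psi k] on the other, while
      admissibility and the Leibniz rule move these operators across a
      multiplication by [x].

    Except for coassociativity, these are treated as identities between maps
    rather than between sums: [f ⊗ g] acts on tensors functorially
    ([tmap_comp]) and is additive in [f] and in [g] ([tmapDl], [tmapDr]), so
    that it suffices to compare maps on [A] such as [L_(Psi k x)] and
    [L_x \o Phi k + Psi k \o L_x]. *)

(** * Calculus of tensor products of maps *)

Section TensorCalculus.
Variable F : fieldType.
Implicit Types U V W : vectType F.

HB.instance Definition _ U V U' V' (f : U -> U') (g : V -> V') :=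
  GRing.isLinear.Build F (tensor U V) (tensor U' V') _ (tmap f g)
    (tlift_linear (fun u v => f u ⊗ g v)).

HB.instance Definition _ U V :=
  GRing.isLinear.Build F (tensor U V) (tensor V U) _ (@tswap F U V)
    (tlift_linear (fun u v => v ⊗ u)).

HB.instance Definition _ U V W :=
  GRing.isLinear.Build F (tensor (tensor U V) W) (tensor U (tensor V W)) _
    (@tassoc F U V W)
    (tlift_linear (fun t w => tlift (fun u v => u ⊗ (v ⊗ w)) t)).

HB.instance Definition _ U V (u : U) :=
  GRing.isLinear.Build F V (tensor U V) _ (tpure u) (tpure_linearr u).

(** The other partial application of [⊗], named so that it can carry a linear
    structure. *)
Definition tpurer U V (v : V) (u : U) : tensor U V := u ⊗ v.

HB.instance Definition _ U V (v : V) :=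
  GRing.isLinear.Build F U (tensor U V) _ (tpurer v) (tpure_linearl v).

Lemma tpureBl U V (u u' : U) (v : V) : (u - u') ⊗ v = u ⊗ v - u' ⊗ v.
Proof. exact: (linearB (tpurer v)). Qed.

Lemma tpure_suml U V (I : finType) (a : I -> U) (v : V) :
  (\sum_i a i) ⊗ v = \sum_i a i ⊗ v.
Proof. exact: (linear_sum (tpurer v)). Qed.

(** A single index suffices: summing a matrix of coordinates along its rows
    leaves one pure tensor for each basis vector of [U]. *)
Lemma tensor_sum_pure U V (t : tensor U V) :
  exists n (a : 'I_n -> U) (b : 'I_n -> V), t = \sum_i a i ⊗ b i.
Proof.
exists (\dim {:U}), (fun i => (vbasis {:U})`_i).
exists (fun i => \sum_j t i j *: (vbasis {:V})`_j).
rewrite [LHS]tensor_expand; apply: eq_bigr => i _.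
by rewrite linear_sum; apply: eq_bigr => j _; rewrite linearZ.
Qed.

Lemma tmap_tpure U V U' V' (f : U -> U') (g : V -> V') u v :
  linear f -> linear g -> tmap f g (u ⊗ v) = f u ⊗ g v.
Proof.
move=> lf lg; apply: tlift_tpure => [y|x] c z z'.
  by rewrite lf tpure_linearl.
by rewrite lg tpure_linearr.
Qed.

Lemma tmap_sum U V U' V' (f : U -> U') (g : V -> V') n
    (a : 'I_n -> U) (b : 'I_n -> V) :
  linear f -> linear g ->
  tmap f g (\sum_i a i ⊗ b i) = \sum_i f (a i) ⊗ g (b i).
Proof.
by move=> lf lg; rewrite linear_sum; apply: eq_bigr => i _; exact: tmap_tpure.
Qed.

Lemma tmap_sum2 U V U' V' (f : U -> U') (g : V -> V') n
    (a : 'I_n -> 'I_n -> U) (b : 'I_n -> 'I_n -> V) :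
  linear f -> linear g ->
  tmap f g (\sum_i \sum_j a i j ⊗ b i j) =
    \sum_i \sum_j f (a i j) ⊗ g (b i j).
Proof.
move=> lf lg; rewrite (linear_sum (tmap f g)); apply: eq_bigr => i _.
exact: tmap_sum.
Qed.

Lemma tswap_tpure U V (u : U) (v : V) : tswap (u ⊗ v) = v ⊗ u.
Proof.
apply: tlift_tpure => [y|x] c z z'; first exact: tpure_linearr.
exact: tpure_linearl.
Qed.

Lemma tassoc_tpure U V W (u : U) (v : V) (w : W) :
  tassoc (u ⊗ v ⊗ w) = u ⊗ (v ⊗ w).
Proof.
rewrite /tassoc tlift_tpure.
- apply: tlift_tpure => [y|x] c z z'; first exact: tpure_linearl.
  by rewrite tpure_linearl tpure_linearr.
- by move=> y; exact: tlift_linear.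
- move=> t c z z'; rewrite /tlift scaler_sumr -big_split /=.
  apply: eq_bigr => i _; rewrite scaler_sumr -big_split /=.
  apply: eq_bigr => j _.
  by rewrite !tpure_linearr scalerDr !scalerA mulrC.
Qed.

Lemma eq_tmap U V U' V' (f f' : U -> U') (g g' : V -> V') t :
  f =1 f' -> g =1 g' -> tmap f g t = tmap f' g' t.
Proof.
move=> eqf eqg; apply: eq_bigr => i _; apply: eq_bigr => j _.
by rewrite eqf eqg.
Qed.

Lemma tmap_linearl U V U' V' c (f f' : U -> U') (g : V -> V') t :
  tmap (fun u => c *: f u + f' u) g t = c *: tmap f g t + tmap f' g t.
Proof.
rewrite /tmap /tlift scaler_sumr -big_split; apply: eq_bigr => i _.
rewrite scaler_sumr -big_split; apply: eq_bigr => j _ /=.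
by rewrite tpure_linearl scalerDr !scalerA mulrC.
Qed.

Lemma tmap_linearr U V U' V' c (f : U -> U') (g g' : V -> V') t :
  tmap f (fun v => c *: g v + g' v) t = c *: tmap f g t + tmap f g' t.
Proof.
rewrite /tmap /tlift scaler_sumr -big_split; apply: eq_bigr => i _.
rewrite scaler_sumr -big_split; apply: eq_bigr => j _ /=.
by rewrite tpure_linearr scalerDr !scalerA mulrC.
Qed.

Lemma tmapDl U V U' V' (f f' : U -> U') (g : V -> V') t :
  tmap (fun u => f u + f' u) g t = tmap f g t + tmap f' g t.
Proof.
rewrite -[tmap f g t]scale1r -tmap_linearl.
by apply: eq_tmap => // u; rewrite scale1r.
Qed.

Lemma tmapDr U V U' V' (f : U -> U') (g g' : V -> V') t :
  tmap f (fun v => g v + g' v) t = tmap f g t + tmap f g' t.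
Proof.
rewrite -[tmap f g t]scale1r -tmap_linearr.
by apply: eq_tmap => // u; rewrite scale1r.
Qed.

(** Only the outer maps have to be linear, because [tmap f' g' t] evaluates
    [f'] and [g'] on basis vectors alone. *)
Lemma tmap_comp U V U' V' U'' V'' (f : U' -> U'') (g : V' -> V'')
    (f' : U -> U') (g' : V -> V') t :
  linear f -> linear g ->
  tmap f g (tmap f' g' t) = tmap (f \o f') (g \o g') t.
Proof.
move=> lf lg; rewrite [tmap f' g' t]/tmap /tlift linear_sum.
apply: eq_bigr => i _; rewrite linear_sum; apply: eq_bigr => j _.
by rewrite linearZ /= tmap_tpure.
Qed.

Lemma tswap_tmap U V U' V' (f : U -> U') (g : V -> V') t :
  linear f -> linear g -> tswap (tmap f g t) = tmap g f (tswap t).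
Proof.
move=> lf lg; have [n [a [b ->]]] := tensor_sum_pure t.
have swE (X Y : vectType F) (x : 'I_n -> X) (y : 'I_n -> Y) :
    tswap (\sum_i x i ⊗ y i) = \sum_i y i ⊗ x i.
  by rewrite linear_sum; apply: eq_bigr => i _; exact: tswap_tpure.
by rewrite tmap_sum // !swE tmap_sum.
Qed.

End TensorCalculus.

(** * Coboundary coproducts *)

Section Coboundary.
Variables (F : fieldType) (A : vectType F) (mul : A -> A -> A).
Hypothesis algA : is_algebra mul.
Implicit Types (r : tensor A A) (f g : 'End(A)).

Local Notation L := (Lmul mul).
Local Notation R := (Rmul mul).

Definition coboundary r (x : A) : tensor A A :=
  tmap id (L x) r - tmap (R x) id r.

Definition AYBE_expr r : tensor A (tensor A A) :=
  r12r13 mul r + r13r23 mul r - r23r12 mul r.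

Let linL x : linear (L x). Proof. exact: alg_linearr algA x. Qed.
Let linR x : linear (R x). Proof. exact: alg_linearl algA x. Qed.
Let lin_id (V : vectType F) : linear (@id V). Proof. by []. Qed.
Let lin_end f : linear f. Proof. exact: linearP. Qed.
Let lin_tmap (f g : A -> A) : linear (tmap f g). Proof. exact: linearP. Qed.
Let mulA : associative mul. Proof. exact: alg_assoc algA. Qed.

#[local] Hint Resolve linL linR lin_id lin_end lin_tmap : core.

Lemma coboundary_linear r : linear (coboundary r).
Proof.
move=> c x y; rewrite /coboundary.
have -> : tmap id (L (c *: x + y)) r = c *: tmap id (L x) r + tmap id (L y) r.
  rewrite -tmap_linearr; apply: eq_tmap => // z.
  exact: alg_linearl algA z c x y.
have -> : tmap (R (c *: x + y)) id r = c *: tmap (R x) id r + tmap (R y) id r.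
  rewrite -tmap_linearl; apply: eq_tmap => // z.
  exact: alg_linearr algA z c x y.
by rewrite scalerBr opprD addrACA.
Qed.

Lemma tmap_coboundary (f g : A -> A) r x :
  linear f -> linear g ->
  tmap f g (coboundary r x) = tmap f (g \o L x) r - tmap (f \o R x) g r.
Proof. by move=> lf lg; rewrite linearB /= !tmap_comp. Qed.

Lemma coboundary_mul r x y :
  coboundary r (mul x y) =
    tmap (R y) id (coboundary r x) + tmap id (L x) (coboundary r y).
Proof.
rewrite !tmap_coboundary // addrC addrA subrK.
by congr (_ - _); apply: eq_tmap => // z; rewrite /Lmul /Rmul /= mulA.
Qed.

(** The flip exchanges the two legs of [r]; since [L_x] and [R_y] commute by
    associativity, the right-hand side is the left-hand side computed from
    [- tswap r]. *)
Lemma coboundary_swap r x y : is_antisymmetric r ->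
  tmap (L x) id (coboundary r y) - tmap id (R x) (coboundary r y) =
    tswap (tmap id (R y) (coboundary r x) - tmap (L y) id (coboundary r x)).
Proof.
move=> ranti; have swr : tswap r = - r by rewrite [in RHS]ranti opprK.
have swE (f g : A -> A) : linear f -> linear g ->
    tswap (tmap f g r) = - tmap g f r.
  by move=> lf lg; rewrite tswap_tmap // swr linearN.
have linLR u v : linear (L u \o R v) by move=> c z z'; rewrite /= linR linL.
have linRL u v : linear (R u \o L v) by move=> c z z'; rewrite /= linL linR.
have idE (f : A -> A) : id \o f = f by [].
rewrite !tmap_coboundary // !linearB /= !idE !swE // !opprK.
have -> : tmap (R y \o L x) id r = tmap (L x \o R y) id r.
  by apply: eq_tmap => // z; rewrite /Lmul /Rmul /= mulA.
have -> : tmap id (L y \o R x) r = tmap id (R x \o L y) r.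
  by apply: eq_tmap => // z; rewrite /Lmul /Rmul /= mulA.
by rewrite [in RHS]addrC addrACA.
Qed.

(** How the linear equations on [r] are used: an operator that is innermost on
    one leg can be moved to the other leg, where it becomes its partner. *)
Lemma tmap_transfer r d e (f g : A -> A) :
  tmap d id r = tmap id e r -> linear f -> linear g ->
  tmap (f \o d) g r = tmap f (g \o e) r.
Proof.
move=> rde lf lg; transitivity (tmap f g (tmap d id r)).
  by rewrite tmap_comp.
by rewrite rde tmap_comp.
Qed.

Section DifferentialConditions.
Variables (r : tensor A A) (d e : 'End(A)).
Hypothesis rde : tmap d id r = tmap id e r.
Hypothesis red : tmap e id r = tmap id d r.
Hypothesis adml : forall a b, mul (e a) b = mul a (d b) + e (mul a b).
Hypothesis admr : forall a b, mul a (e b) = mul (d a) b + e (mul a b).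

(** Admissibility rewrites [L_(e x)] as [L_x \o d + e \o L_x] and [R_(e x)] as
    [R_x \o d + e \o R_x]; transferring [d] to the other leg turns it into
    [e], which leaves [e] acting on each leg of the coproduct of [x]. *)
Lemma coboundary_coderivation : is_coderivation (coboundary r) e.
Proof.
move=> x; rewrite !tmap_coboundary //.
have -> : coboundary r (e x) =
    tmap id (fun b => (L x \o d) b + (e \o L x) b) r
    - tmap (fun b => (R x \o d) b + (e \o R x) b) id r.
  by congr (_ - _); apply: eq_tmap => // b; exact: admr.
rewrite tmapDl tmapDr (tmap_transfer rde (f := R x) (g := id)) //.
rewrite -(tmap_transfer red (f := id) (g := L x)) //.
by rewrite opprD [- _ - _]addrC addrACA.
Qed.

Hypothesis der : is_derivation mul d.

(** The Leibniz rule splits [d \o R_x], admissibility splits [L_x \o e], and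
    the pieces [L_(d x)] and [R_(d x)] make up the coproduct of [d x]. *)
Lemma coboundary_derivationl x :
  tmap d id (coboundary r x) =
    tmap id e (coboundary r x) + coboundary r (d x).
Proof.
rewrite !tmap_coboundary // (tmap_transfer rde (f := id) (g := L x)) //.
have -> : tmap id (L x \o e) r =
    tmap id (fun b => (e \o L x) b + L (d x) b) r.
  by apply: eq_tmap => // b; rewrite addrC; exact: admr.
have -> : tmap (d \o R x) id r =
    tmap (fun b => (R x \o d) b + R (d x) b) id r.
  by apply: eq_tmap => // b; exact: der.
rewrite tmapDl tmapDr (tmap_transfer rde (f := R x) (g := id)) //.
by rewrite opprD addrACA.
Qed.

(** The mirror image of [coboundary_derivationl]: the Leibniz rule now splits
    [d \o L_x], and the other half of admissibility splits [R_x \o e]. *)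
Lemma coboundary_derivationr x :
  tmap id d (coboundary r x) =
    tmap e id (coboundary r x) + coboundary r (d x).
Proof.
rewrite !tmap_coboundary // -(tmap_transfer red (f := R x) (g := id)) //.
have -> : tmap (R x \o e) id r =
    tmap (fun b => (e \o R x) b + R (d x) b) id r.
  by apply: eq_tmap => // b; rewrite addrC; exact: adml.
have -> : tmap id (d \o L x) r =
    tmap id (fun b => (L x \o d) b + L (d x) b) r.
  by apply: eq_tmap => // b; rewrite addrC; exact: der.
rewrite tmapDl tmapDr -(tmap_transfer red (f := id) (g := L x)) //.
by rewrite opprD addrACA.
Qed.

End DifferentialConditions.

Section Coassociativity.
Variables (n : nat) (a b : 'I_n -> A).
Let r : tensor A A := \sum_i a i ⊗ b i.

Lemma coboundaryE x :
  coboundary r x = \sum_i a i ⊗ mul x (b i) - \sum_i mul (a i) x ⊗ b i.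
Proof. by rewrite /coboundary !tmap_sum. Qed.

(** Each iterated coproduct has four terms.  According to the slot of
    [A ⊗ A ⊗ A] that [x] multiplies, they are images of the three terms of the
    Yang-Baxter equation under [L_x] on the last slot, images of these under
    [R_x] on the first slot, and a middle term that both sides share. *)
Lemma coboundary_coassocE x :
  tassoc (tmap (coboundary r) id (coboundary r x)) -
    tmap id (coboundary r) (coboundary r x) =
  tmap (R x) id (AYBE_expr r) - tmap id (tmap id (L x)) (AYBE_expr r).
Proof.
have lc : linear (coboundary r) by exact: coboundary_linear.
have assocE y z : tassoc (coboundary r y ⊗ z) =
    \sum_j a j ⊗ (mul y (b j) ⊗ z) - \sum_j mul (a j) y ⊗ (b j ⊗ z).
  rewrite coboundaryE tpureBl !tpure_suml linearB /=.
  rewrite !(linear_sum (@tassoc F _ _ _)).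
  by congr (_ - _); apply: eq_bigr => j _; exact: tassoc_tpure.
have rightE y z : y ⊗ coboundary r z =
    \sum_j y ⊗ (a j ⊗ mul z (b j)) - \sum_j y ⊗ (mul (a j) z ⊗ b j).
  by rewrite coboundaryE linearB !linear_sum.
(* [Pst] and [Qst] come from the Yang-Baxter term that starts
   with the factor [rst]: 12 from [r12r13], 13 from [r13r23], 23 from
   [r23r12].  [x] sits in the last slot of [Pst], the first slot of [Qst] and
   the middle slot of [M]. *)
pose P12 : tensor A (tensor A A) :=
  \sum_i \sum_j mul (a i) (a j) ⊗ (b i ⊗ mul x (b j)).
pose P13 : tensor A (tensor A A) :=
  \sum_i \sum_j a i ⊗ (a j ⊗ mul x (mul (b i) (b j))).
pose P23 : tensor A (tensor A A) :=
  \sum_i \sum_j a j ⊗ (mul (a i) (b j) ⊗ mul x (b i)).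
pose Q12 : tensor A (tensor A A) :=
  \sum_i \sum_j mul (mul (a i) (a j)) x ⊗ (b i ⊗ b j).
pose Q13 : tensor A (tensor A A) :=
  \sum_i \sum_j mul (a i) x ⊗ (a j ⊗ mul (b i) (b j)).
pose Q23 : tensor A (tensor A A) :=
  \sum_i \sum_j mul (a j) x ⊗ (mul (a i) (b j) ⊗ b i).
pose M : tensor A (tensor A A) :=
  \sum_i \sum_j a j ⊗ (mul (mul (a i) x) (b j) ⊗ b i).
have -> : tassoc (tmap (coboundary r) id (coboundary r x)) =
    (P23 - P12) - (M - Q12).
  rewrite [coboundary r x]coboundaryE (linearB (tmap _ _)) /= !tmap_sum //.
  rewrite (linearB (@tassoc F _ _ _)) !(linear_sum (@tassoc F _ _ _)).
  rewrite [P12]exchange_big [Q12]exchange_big /P23 /M -!sumrB /=.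
  apply: eq_bigr => i _; rewrite !assocE; congr (_ - (_ - _)).
  by apply: eq_bigr => j _; rewrite mulA.
have -> : tmap id (coboundary r) (coboundary r x) =
    (P13 - M) - (Q13 - Q23).
  rewrite [coboundary r x]coboundaryE (linearB (tmap _ _)) /= !tmap_sum //.
  rewrite [M]exchange_big [Q23]exchange_big /P13 /Q13 -!sumrB /=.
  apply: eq_bigr => i _; rewrite !rightE; congr (_ - _ - _).
    by apply: eq_bigr => j _; rewrite mulA.
  by apply: eq_bigr => j _; rewrite mulA.
have -> : tmap (R x) id (AYBE_expr r) = Q12 + Q13 - Q23.
  rewrite /AYBE_expr r12r13E // r13r23E // r23r12E // linearB linearD /=.
  by rewrite !tmap_sum2.
have -> : tmap id (tmap id (L x)) (AYBE_expr r) = P12 + P13 - P23.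
  rewrite /AYBE_expr r12r13E // r13r23E // r23r12E // linearB linearD /=.
  rewrite !tmap_sum2 //; congr (_ + _ - _); apply: eq_bigr => i _;
    by apply: eq_bigr => j _; rewrite tmap_tpure.
rewrite opprB addrA [P13 - M - _]addrAC opprB addrA subrK !opprB opprD.
by rewrite [LHS](AC (3*3)%AC ((3*4*5)*(1*(2*6)))%AC).
Qed.

End Coassociativity.

Lemma coboundary_coassoc r x : AYBE_expr r = 0 ->
  tassoc (tmap (coboundary r) id (coboundary r x)) =
    tmap id (coboundary r) (coboundary r x).
Proof.
have [n [a [b ->]]] := tensor_sum_pure r => Y0.
by apply/eqP; rewrite -subr_eq0 coboundary_coassocE Y0 !linear0 addr0.
Qed.

Lemma coboundary_ASI r :
  is_antisymmetric r -> AYBE_expr r = 0 -> is_ASI_bialgebra mul (coboundary r).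
Proof.
move=> ranti Y0; split=> //.
- split; first exact: coboundary_linear.
  by move=> x; exact: coboundary_coassoc.
- exact: coboundary_mul.
- by move=> x y; exact: coboundary_swap.
Qed.

End Coboundary.

Theorem corollary4p9 (F : fieldType) (charF0 : [pchar F] =i pred0)
    (A : vectType F) (mul : A -> A -> A)
    (m : nat) (Phi Psi : 'I_m -> 'End(A)) (r : tensor A A) :
  is_diff_algebra mul Phi ->
  is_admissible mul Phi Psi ->
  is_antisymmetric r ->
  is_admissible_AYBE_solution mul Phi Psi r ->
  is_diff_ASI_bialgebra mul
    (fun a : A => tmap id (Lmul mul a) r - tmap (Rmul mul a) id r) Phi Psi.
Proof.
move=> diffA adm ranti [aybe rPhi rPsi].
have [algA der _] := diffA; have [_ adml admr] := adm.
have rde k : tmap (Phi k) id r = tmap id (Psi k) r.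
  by apply/eqP; rewrite -subr_eq0 rPhi.
have red k : tmap (Psi k) id r = tmap id (Phi k) r.
  by apply/eqP; rewrite -subr_eq0 rPsi.
split=> // [|k|k x|k x].
- exact: coboundary_ASI.
- exact: coboundary_coderivation (rde k) (red k) (adml k) (admr k).
- exact: coboundary_derivationl (rde k) (admr k) (der k) x.
- exact: coboundary_derivationr (red k) (adml k) (der k) x.
Qed.
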